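(* Let $m$ be a positive integer, let $K$ be an integer with $0\le K\le m-1$, and let $a_1$ be a non-negative integer. Then $$S_m(\{a_1\},K)=\left\lfloor\frac{a_1}{m}\right\rfloor (K+1)+\max\bigl(0,\,(a_1 \bmod m)+K-m+1\bigr).$$
   Context: For a positive integer $m$ and non-negative integers $a_1,K$, define $$S_m(\{a_1\},K)=\sum_{k=0}^K\left(\left\lfloor\frac{a_1+k}{m}\right\rfloor-\left\lfloor\frac{k}{m}\right\rfloor\right).$$ For an integer $a$, $(a \bmod m)$ denotes the minimal non-negative representative of the class of $a$ in $\mathbb{Z}/m$, i.e. the integer in $\{0,\dots,m-1\}$ congruent to $a$ modulo $m$. *)

(* Defs.v *)
From mathcomp Require Import all_boot all_order all_algebra.

Set Implicit Arguments.
Unset Strict Implicit.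
Unset Printing Implicit Defensive.

Import GRing.Theory Num.Theory.
Local Open Scope ring_scope.

(* S_m({a}, K): the sum has K + 1 terms, and both the division (in rat) and
   the difference of the floors (in int) are the untruncated ones. *)
Definition Ssum (m a K : nat) : int :=
  \sum_(0 <= k < K.+1)
    (Num.floor ((a + k)%N%:R / m%:R : rat) - Num.floor (k%:R / m%:R : rat)).

(* Main.v *)
Require Import Defs.
From mathcomp Require Import all_boot all_order all_algebra.
From mathcomp Require Import zify.

Set Implicit Arguments.
Unset Strict Implicit.
Unset Printing Implicit Defensive.

Import Order.TTheory GRing.Theory Num.Theory.
Local Open Scope ring_scope.

(* For 0 <= k < m the k-th summand is the quotient of a by m plus a carry bit,
   which is 1 exactly when k >= m - (a mod m).  As a mod m < m, there is no
   carry at k = 0, so counting the carries up to K gives the maximum. *)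

Lemma floor_divn (R : archiRealFieldType) (a m : nat) :
  (0 < m)%N -> Num.floor (a%:R / m%:R : R) = (a %/ m)%N%:Z.
Proof.
move=> m_gt0; apply: floor_def.
have m_gt0R : 0 < m%:R :> R by rewrite ltr0n.
(* Clearing the denominator leaves [q * m <= a < (q + 1) * m] in [nat], with [q = a %/ m]: Euclidean
   division. *)
rewrite ler_pdivlMr // ltr_pdivrMr // -PoszD -!pmulrn -!natrM ler_nat ltr_nat.
by rewrite leq_divM addn1 ltn_ceil.
Qed.

Lemma floor_divnD_sub (R : archiRealFieldType) (m a k : nat) : (k < m)%N ->
  Num.floor ((a + k)%N%:R / m%:R : R) - Num.floor (k%:R / m%:R : R) =
  (a %/ m)%N%:Z + (m <= a %% m + k)%N%:Z.
Proof.
move=> lt_km; have m_gt0 : (0 < m)%N by apply: leq_ltn_trans lt_km.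
(* The carry bit comes from [divnD]; since [k < m], [k] has quotient 0 and is its own remainder. *)
rewrite !floor_divn // divnD // (divn_small lt_km) (modn_small lt_km).
by rewrite addn0 subr0 PoszD.
Qed.

Theorem proposition2 (m K a1 : nat) (hm : (0 < m)%N) (hK : (K <= m - 1)%N) :
  Ssum m a1 K =
    Num.floor (a1%:R / m%:R : rat) * (K%:Z + 1) +
    Num.max (0 : int) ((a1 %% m)%N%:Z + K%:Z - m%:Z + 1).
Proof.
rewrite floor_divn // /Ssum; have lt_rm := ltn_pmod a1 hm.
elim: K hK => [|K IHK] hK.
  by rewrite big_nat1 floor_divnD_sub //; lia.
rewrite big_nat_recr //= IHK; last by lia.
(* From [K] to [K.+1] the maximum grows by 1 exactly when [m <= a1 %% m + K.+1], which is the carry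
   at index [K.+1]. *)
by rewrite floor_divnD_sub; lia.
Qed.
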